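(* Let $x_1,x_2,\dots$ be indeterminates. Then $$\sum_{n\ge0}\sum_{\pi\in\mathfrak M_n}\prod_{j\ge1}x_j^{12\ldots j(\pi)} =\cfrac{1}{1-x_1-\cfrac{x_1^2x_2}{1-x_1x_2-\cfrac{x_1^2x_2^3x_3}{1-x_1x_2^2x_3-\cfrac{x_1^2x_2^5x_3^4x_4}{\ddots}}}},$$ where, writing the continued fraction as $\cfrac{1}{1-a_1-\cfrac{b_1}{1-a_2-\cfrac{b_2}{1-a_3-\cdots}}}$, the $n$-th numerator is $b_n=\prod_{i=1}^{n+1}x_i^{\binom{n}{i-1}+\binom{n-1}{i-1}}$ and $a_n=\prod_{i=1}^{n}x_i^{\binom{n-1}{i-1}}$ for $n\ge1$.
   Context: A permutation $\pi=\pi_1\cdots\pi_n$ is a Motzkin permutation if it avoids the pattern $132$ (no $i<j<k$ with $\pi_i<\pi_k<\pi_j$) and there are no indices $a<b$ with $\pi_a<\pi_b<\pi_{b+1}$; $\mathfrak M_n$ denotes the set of Motzkin permutations of length $n$. For $j\ge1$, $12\ldots j(\pi)$ denotes the number of occurrences of the classical pattern $12\ldots j$ in $\pi$, i.e. the number of index sets $i_1<\dots<i_j$ with $\pi_{i_1}<\dots<\pi_{i_j}$ (so $12\ldots j(\pi)$ for $j=1$ is $n$). *)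

(* Defs.v *)
From HB Require Import structures.
From mathcomp Require Import all_boot all_order all_fingroup all_algebra.
From mathcomp Require Import finmap boolp classical_sets cardinality.
From mathcomp Require Import monalg.

Set Implicit Arguments.
Unset Strict Implicit.
Unset Printing Implicit Defensive.

Import GRing.Theory.
Local Open Scope ring_scope.

(* Z[[x_0, x_1, x_2, ...]]: arbitrary integer functions on the monomials in
   countably many variables, with the Cauchy product.  The variable x_0 is never
   used, so that x_j keeps its usual index j >= 1. *)
Notation mon := {cmonom nat}.

Record fps := Fps { fcoef : mon -> int }.

HB.instance Definition _ := [isNew for fcoef].
HB.instance Definition _ := [Choice of fps by <:].

Lemma fpsP (f g : fps) : fcoef f =1 fcoef g -> f = g.
Proof. by case: f g => [f] [g] /= /funext->. Qed.

Definition fps_zero := Fps (fun=> 0).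
Definition fps_opp f := Fps (fun m => - fcoef f m).
Definition fps_add f g := Fps (fun m => fcoef f m + fcoef g m).

Lemma fps_addA : associative fps_add.
Proof. by move=> f g h; apply: fpsP => m /=; rewrite addrA. Qed.
Lemma fps_addC : commutative fps_add.
Proof. by move=> f g; apply: fpsP => m /=; rewrite addrC. Qed.
Lemma fps_add0 : left_id fps_zero fps_add.
Proof. by move=> f; apply: fpsP => m /=; rewrite add0r. Qed.
Lemma fps_addN : left_inverse fps_zero fps_opp fps_add.
Proof. by move=> f; apply: fpsP => m /=; rewrite addNr. Qed.

HB.instance Definition _ :=
  GRing.isZmodule.Build fps fps_addA fps_addC fps_add0 fps_addN.

Definition factorizations (m : mon) : {fset mon * mon} :=
  fset_set [set p : mon * mon | mmul p.1 p.2 = m]%classic.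

Lemma le_mdeg (m : mon) i : (m i <= mdeg m)%N.
Proof.
have [->//|im] := eqVneq (m i) 0%N.
by rewrite mdegE (big_fsetD1 i) ?leq_addr // -cmE_neq0.
Qed.

Lemma finite_factorizations (m : mon) :
  finite_set [set p : mon * mon | mmul p.1 p.2 = m]%classic.
Proof.
pose E := {ffun finsupp m -> 'I_(mdeg m).+1}.
pose mk (f : E) : mon := [cmonom (f i : nat) | i : finsupp m]%M.
have mkP (d : mon) : (forall i, d i <= m i)%N -> exists f, mk f = d.
  move=> dm; exists [ffun i => inord (d (val i))].
  apply/eqP/cmP => i; rewrite /mk cmE /= fsfun_ffun.
  case: insubP => [u _ ui|]; rewrite /= ?ffunE.
    by rewrite inordK ui // ltnS (leq_trans (dm i)) ?le_mdeg.
  by rewrite -cmE_eq0 => /eqP mi; have := dm i; rewrite mi leqn0 => /eqP.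
pose X : {fset mon * mon} := [fset (mk u.1, mk u.2) | u in {: E * E}]%fset.
apply: (@finite_subfset _ X) => -[d e] /= dem.
have [f fd] : exists f, mk f = d.
  by apply: mkP => i; rewrite -dem cmM leq_addr.
have [g ge] : exists g, mk g = e.
  by apply: mkP => i; rewrite -dem cmM leq_addl.
by apply/imfsetP; exists (f, g) => //=; rewrite fd ge.
Qed.

Lemma in_factorizations (m : mon) p :
  (p \in factorizations m) = (mmul p.1 p.2 == m).
Proof.
rewrite in_fset_set; last exact: finite_factorizations.
by apply/idP/eqP => [/set_mem|?]; [|apply/mem_set].
Qed.

Definition fps_one := Fps (fun m => (m == mone)%:R).
Definition fps_mul f g := Fps (fun m =>
  \sum_(p <- factorizations m) fcoef f p.1 * fcoef g p.2).

Definition mdivisors (m : mon) : {fset mon} :=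
  [fset p.1 | p in factorizations m]%fset.

Lemma mem_mdivisors (m d e : mon) :
  mmul d e = m -> (d \in mdivisors m) /\ (e \in mdivisors m).
Proof.
by move=> dem; split; apply/imfsetP; [exists (d, e)|exists (e, d)] => //=;
  rewrite in_factorizations /= ?[mmul e d]mulmC dem.
Qed.

Lemma mdivisors_closed (m d a b : mon) : d \in mdivisors m -> mmul a b = d ->
  (a \in mdivisors m) /\ (b \in mdivisors m).
Proof.
case/imfsetP => -[d' e] /=; rewrite in_factorizations /= => /eqP dem -> abd.
split; [apply: (proj1 (mem_mdivisors (e := mmul b e) _))
       |apply: (proj1 (mem_mdivisors (e := mmul a e) _))].
  by rewrite mulmA abd.
by rewrite mulmA [mmul b a]mulmC abd.
Qed.

Lemma fcoef_mulE (D : {fset mon}) f g (m : mon) :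
    (forall d e, mmul d e = m -> (d \in D) /\ (e \in D)) ->
  fcoef (fps_mul f g) m =
  \sum_(d <- D) \sum_(e <- D) (fcoef f d * fcoef g e) *+ (mmul d e == m).
Proof.
move=> mD; pose DD := [seq (d, e) | d <- D, e <- D].
transitivity (\sum_(p <- DD | mmul p.1 p.2 == m) fcoef f p.1 * fcoef g p.2).
  rewrite -big_filter /=; apply: perm_big; apply: uniq_perm; first exact: fset_uniq.
    apply: filter_uniq; apply: allpairs_uniq => // -[? ?] [? ?] _ _ //.
  move=> -[d e]; rewrite in_factorizations mem_filter /=.
  case: eqP => //= /mD[dD eD]; symmetry.
  by apply/allpairsP; exists (d, e).
rewrite big_mkcond big_allpairs /=.
by apply: eq_bigr => d _; apply: eq_bigr => e _; rewrite mulrb.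
Qed.

Lemma fps_mulC : commutative fps_mul.
Proof.
move=> f g; apply: fpsP => m; rewrite !(fcoef_mulE _ _ (@mem_mdivisors m)).
rewrite exchange_big; apply: eq_bigr => d _; apply: eq_bigr => e _.
by rewrite mulrC mulmC.
Qed.

Lemma fps_mulA : associative fps_mul.
Proof.
move=> f g h; apply: fpsP => m; rewrite !(fcoef_mulE _ _ (@mem_mdivisors m)).
set D := mdivisors m.
have DE (u v : fps) d : d \in D -> fcoef (fps_mul u v) d =
    \sum_(a <- D) \sum_(b <- D) (fcoef u a * fcoef v b) *+ (mmul a b == d).
  by move=> dD; apply: fcoef_mulE => a b; apply: mdivisors_closed.
pose T := \sum_(a <- D) \sum_(b <- D) \sum_(c <- D)
  (fcoef f a * fcoef g b * fcoef h c) *+ (mmul a (mmul b c) == m).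
transitivity T.
  rewrite /T; apply: eq_big_seq => a aD.
  transitivity (\sum_(e <- D) \sum_(b <- D) \sum_(c <- D)
    (fcoef f a * fcoef g b * fcoef h c)
      *+ ((e == mmul b c) && (mmul a e == m))).
    apply: eq_big_seq => e eD; rewrite DE // mulr_sumr -sumrMnl.
    apply: eq_bigr => b _; rewrite mulr_sumr -sumrMnl.
    apply: eq_bigr => c _.
    by rewrite mulrnAr mulrA -mulrnA mulnb eq_sym.
  rewrite exchange_big; apply: eq_bigr => b _.
  rewrite exchange_big; apply: eq_bigr => c _ /=.
  have [abcm|abcm] := eqVneq (mmul a (mmul b c)) m; last first.
    rewrite big1_seq // => e _; case: eqVneq => // ->; rewrite (negbTE abcm).
    by rewrite mulr0n.
  have [_ bcD] := mem_mdivisors abcm.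
  rewrite (big_fsetD1 (mmul b c)) //= eqxx abcm eqxx big1_seq ?addr0 // => e.
  by rewrite in_fsetD1 => /andP[_ /andP[/negbTE-> _]].
rewrite /T.
transitivity (\sum_(e <- D) \sum_(c <- D) \sum_(a <- D) \sum_(b <- D)
    (fcoef f a * fcoef g b * fcoef h c)
      *+ ((e == mmul a b) && (mmul e c == m))); last first.
  apply: eq_big_seq => e eD; apply: eq_bigr => c _.
  rewrite DE // mulr_suml -sumrMnl.
  apply: eq_bigr => a _; rewrite mulr_suml -sumrMnl.
  apply: eq_bigr => b _.
  by rewrite mulrnAl -mulrnA mulnb eq_sym.
rewrite [RHS]exchange_big /=.
under [RHS]eq_bigr => c _ do rewrite exchange_big /=.
rewrite [RHS]exchange_big; apply: eq_bigr => a _ /=.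
under [RHS]eq_bigr => c _ do rewrite exchange_big /=.
rewrite [RHS]exchange_big; apply: eq_bigr => b _ /=.
apply: eq_bigr => c _.
have [abcm|abcm] := eqVneq (mmul a (mmul b c)) m; last first.
  rewrite big1_seq // => e _; case: eqVneq => // ->.
  by rewrite -mulmA (negbTE abcm) mulr0n.
rewrite mulmA in abcm.
have [abD _] := mem_mdivisors abcm.
rewrite (big_fsetD1 (mmul a b)) //= eqxx abcm eqxx big1_seq ?addr0 // => e.
by rewrite in_fsetD1 => /andP[_ /andP[/negbTE-> _]].
Qed.

Lemma fps_mul1 : left_id fps_one fps_mul.
Proof.
move=> f; apply: fpsP => m; have m1m : mmul mone m = m by rewrite mul1m.
rewrite /= (big_fsetD1 (mone, m)) ?in_factorizations /= ?m1m //.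
rewrite eqxx mul1r big1_seq ?addr0 // => -[d e] /=.
rewrite in_fsetD1 in_factorizations /= => /andP[dm /eqP dem].
move: dm; rewrite -dem xpair_eqE; have [->|_ _] := eqVneq d mone.
  by rewrite mul1m eqxx.
by rewrite mul0r.
Qed.

Lemma fps_mulDl : left_distributive fps_mul fps_add.
Proof.
move=> f g h; apply: fpsP => m /=; rewrite -big_split.
by apply: eq_bigr => p _; rewrite mulrDl.
Qed.

Lemma fps_one_neq0 : fps_one != fps_zero.
Proof. by apply/eqP => /(congr1 (fcoef^~ mone)) /=; rewrite eqxx. Qed.

HB.instance Definition _ := GRing.Zmodule_isComNzRing.Build fps
  fps_mulA fps_mulC fps_mul1 fps_mulDl fps_one_neq0.

Arguments fcoef : simpl never.

Lemma fcoef0 m : fcoef 0 m = 0. Proof. by []. Qed.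
Lemma fcoef1 m : fcoef 1 m = (m == mone)%:R. Proof. by []. Qed.
Lemma fcoefD f g m : fcoef (f + g) m = fcoef f m + fcoef g m.
Proof. by []. Qed.
Lemma fcoefN f m : fcoef (- f) m = - fcoef f m. Proof. by []. Qed.
Lemma fcoefM f g m : fcoef (f * g) m =
  \sum_(p <- factorizations m) fcoef f p.1 * fcoef g p.2.
Proof. by []. Qed.
Lemma fcoef_sum I (r : seq I) (P : pred I) (F : I -> fps) m :
  fcoef (\sum_(i <- r | P i) F i) m = \sum_(i <- r | P i) fcoef (F i) m.
Proof. exact: (big_morph (fcoef^~ m)). Qed.

Lemma fcoefM1 f g : fcoef (f * g) mone = fcoef f mone * fcoef g mone.
Proof.
rewrite fcoefM (big_fsetD1 (mone, mone)) ?in_factorizations ?mul1m //=.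
rewrite big1_seq ?addr0 // => -[d e] /=.
rewrite in_fsetD1 in_factorizations /= => /andP[de1 /eqP/unitm[d1 e1]].
by rewrite d1 e1 eqxx in de1.
Qed.

Definition fps_unit : {pred fps} := fun f => `[< exists g : fps, g * f = 1 >].
Definition fps_inv (f : fps) : fps :=
  if pselect (exists g : fps, g * f = 1) is left ex_inv
  then projT1 (cid ex_inv) else f.

Lemma fps_mulVf : {in fps_unit, left_inverse 1 fps_inv *%R}.
Proof.
by move=> f /asboolP fU; rewrite /fps_inv; case: pselect => // ?; case: cid.
Qed.
Lemma fps_unitPl (f g : fps) : g * f = 1 -> fps_unit f.
Proof. by move=> gf1; apply/asboolP; exists g. Qed.
Lemma fps_inv_out : {in [predC fps_unit], fps_inv =1 id}.
Proof. by move=> f /asboolPn fNU; rewrite /fps_inv; case: pselect. Qed.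

HB.instance Definition _ := GRing.ComNzRing_hasMulInverse.Build fps
  fps_mulVf fps_unitPl fps_inv_out.

Lemma fcoef_exp_small (h : fps) k m :
  fcoef h mone = 0 -> (mdeg m < k)%N -> fcoef (h ^+ k) m = 0.
Proof.
move=> h0; elim: k m => // k IHk m mk; rewrite exprS fcoefM big1_seq //.
move=> -[d e] /=; rewrite in_factorizations /= => /eqP dem.
have [->|d1] := eqVneq d mone; first by rewrite h0 mul0r.
rewrite IHk ?mulr0 // -ltnS (leq_trans _ mk) // ltnS -dem mdegM.
by rewrite -[X in (X < _)%N]add0n ltn_add2r lt0n mdeg_eq0.
Qed.

Lemma fps_unit_const1 (f : fps) : fcoef f mone = 1 -> f \is a GRing.unit.
Proof.
move=> f1; pose h := 1 - f.
have h0 : fcoef h mone = 0 by rewrite fcoefD fcoefN f1 fcoef1 eqxx subrr.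
pose S n : fps := \sum_(k < n) h ^+ k.
pose g := Fps (fun m => fcoef (S (mdeg m).+1) m).
have gE n m : (mdeg m < n)%N -> fcoef g m = fcoef (S n) m.
  move=> mn; rewrite -[LHS]/(fcoef (S (mdeg m).+1) m) /S -(subnKC mn).
  rewrite big_split_ord fcoefD.
  rewrite [X in _ + X]fcoef_sum [X in _ + X]big1 ?addr0 // => i _.
  by rewrite fcoef_exp_small // ltn_addr.
suff gf1 : g * f = 1 by apply: fps_unitPl gf1.
apply: fpsP => m; transitivity (fcoef (S (mdeg m).+1 * f) m).
  rewrite !fcoefM; apply: eq_big_seq => -[d e] /=.
  rewrite in_factorizations /= => /eqP dem.
  by rewrite -[X in X * _]/(fcoef g d) (gE (mdeg m).+1) // ltnS -dem mdegM leq_addr.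
have -> : f = 1 - h by rewrite /h opprB addrC subrK.
rewrite mulrC -[1 - h]opprB mulNr -subrX1 opprB fcoefD fcoefN.
by rewrite fcoef_exp_small ?subr0.
Qed.

Definition fps_var (j : nat) : fps := Fps (fun m => (m == ucm j)%:R).
Notation "''x_' j" := (fps_var j) (at level 8, j at level 2, format "''x_' j").

Lemma fcoef_var j m : fcoef 'x_j m = (m == ucm j)%:R.
Proof. by []. Qed.

(* Convergence for the product topology of the discrete topology on Z: every
   coefficient is eventually constant. *)
Definition fps_cvg (u : nat -> fps) (l : fps) : Prop :=
  forall m, exists N, forall n, (N <= n)%N -> fcoef (u n) m = fcoef l m.

Lemma fps_cvg_unique u l1 l2 : fps_cvg u l1 -> fps_cvg u l2 -> l1 = l2.
Proof.
move=> u1 u2; apply: fpsP => m; have [[N1 H1] [N2 H2]] := (u1 m, u2 m).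
by rewrite -(H1 (maxn N1 N2)) ?leq_maxl // H2 ?leq_maxr.
Qed.

(* 1 - a_i - b_i / (1 - a_(i+1) - b_(i+1) / (... / (1 - a_(i+k)))) *)
Fixpoint jfrac_den (a b : nat -> fps) (i k : nat) : fps :=
  1 - a i - (if k is k'.+1 then b i / jfrac_den a b i.+1 k' else 0).

Definition jfrac_convergent (a b : nat -> fps) (k : nat) : fps :=
  1 / jfrac_den a b 1 k.

Lemma jfrac_den_unit (a b : nat -> fps) i k :
    (forall n, (0 < n)%N -> fcoef (a n) mone = 0 /\ fcoef (b n) mone = 0) ->
  (0 < i)%N -> jfrac_den a b i k \is a GRing.unit.
Proof.
move=> ab0; elim: k i => [|k IHk] i i0; apply: fps_unit_const1 => /=;
  have [a0 b0] := ab0 i i0; rewrite !(fcoefD, fcoefN) a0 fcoef1 eqxx !subr0 //.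
by rewrite fcoefM1 b0 mul0r subr0.
Qed.

Definition avoids_132 n (s : 'S_n) : bool :=
  [forall i : 'I_n, forall j : 'I_n, forall k : 'I_n,
    (i < j < k)%N ==> ~~ (s i < s k < s j)%N].

Definition no_ascent_above n (s : 'S_n) : bool :=
  [forall a : 'I_n, forall b : 'I_n, forall c : 'I_n,
    (a < b)%N && (c == b.+1 :> nat) ==> ~~ (s a < s b < s c)%N].

Definition motzkin n (s : 'S_n) : bool := avoids_132 s && no_ascent_above s.

Definition occ_incr n (j : nat) (s : 'S_n) : nat :=
  #|[pred t : j.-tuple 'I_n |
      sorted (fun i i' : 'I_n => i < i')%N t &&
      sorted (fun i i' : 'I_n => s i < s i')%N t]|.

Lemma occ_incr_gt n j (s : 'S_n) : (n < j)%N -> occ_incr j s = 0%N.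
Proof.
move=> nj; apply: eq_card0 => t; rewrite !inE; apply/negP => /andP[t_lt _].
have t_uniq : uniq t.
  apply: (sorted_uniq (leT := fun i i' : 'I_n => (i < i')%N)) t_lt.
    by move=> x y z; apply: ltn_trans.
  by move=> x; apply: ltnn.
have := uniq_leq_size t_uniq (fun x _ => mem_enum 'I_n x).
by rewrite size_tuple size_enum_ord leqNgt nj.
Qed.

(* The factors with j > n are 1, by occ_incr_gt. *)
Definition weight n (s : 'S_n) : fps :=
  \prod_(1 <= j < n.+1) 'x_j ^+ occ_incr j s.

Definition cf_a (n : nat) : fps := \prod_(1 <= i < n.+1) 'x_i ^+ 'C(n.-1, i.-1).

Definition cf_b (n : nat) : fps :=
  \prod_(1 <= i < n.+2) 'x_i ^+ ('C(n, i.-1) + 'C(n.-1, i.-1)).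

Lemma cf_const0 n :
  (0 < n)%N -> fcoef (cf_a n) mone = 0 /\ fcoef (cf_b n) mone = 0.
Proof.
have x10 : fcoef 'x_1 mone = 0 by rewrite fcoef_var eq_sym cm1_eq1.
have x1k k g : (0 < k)%N -> fcoef ('x_1 ^+ k * g) mone = 0.
  by case: k => // k _; rewrite exprS -mulrA fcoefM1 x10 mul0r.
by case: n => // n _; split; rewrite /cf_a /cf_b big_ltn // x1k //= bin0.
Qed.

Lemma cf_den_unit k i : (0 < i)%N -> jfrac_den cf_a cf_b i k \is a GRing.unit.
Proof. exact/jfrac_den_unit/cf_const0. Qed.

(* Main.v *)
Require Import Defs.
From mathcomp Require Import all_boot all_fingroup all_algebra.
From mathcomp Require Import monalg zify ring.

(* A Motzkin permutation is empty, or n tau, or sigma m n tau with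
   sigma > m > tau, where sigma and tau are again Motzkin.  If
   Q(pi) = sum_(j >= 1) 12...j(pi) t^j, then Q(n tau) = t + Q(tau) and
   Q(sigma m n tau) = (1 + t) Q(sigma) + 2t + t^2 + Q(tau).  Let F_k be the sum
   over pi of the monomials whose exponents are the coefficients of
   (1 + t)^k Q(pi).  Then F_k = 1 + a_(k+1) F_k + b_(k+1) F_(k+1) F_k, that is,
   F_k = 1 / (1 - a_(k+1) - b_(k+1) F_(k+1)), and iterating this from F_0 gives
   the continued fraction: every b_k has order 2, so each further level of a
   convergent improves the agreement with F_0 by at least one degree. *)

Set Implicit Arguments.
Unset Strict Implicit.
Unset Printing Implicit Defensive.
Import GRing.Theory.

Local Open Scope nat_scope.

(** * Motzkin words *)

(** Both patterns are tested with the leading letter [a] as their smallest entry, which suits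
    induction on the word. *)
Fixpoint motzkin_word (w : seq nat) : bool :=
  if w is a :: w' then
    [&& pairwise (fun y z => ~~ (a < z < y)%N) w',
        sorted (fun y z => ~~ (a < y < z)%N) w' & motzkin_word w']
  else true.

(* The coefficient of 'X^j, for j >= 1, is the number of increasing subsequences
   of length j with all entries at least lo; the empty one is not counted. *)
Fixpoint chain_poly (lo : nat) (w : seq nat) : {poly nat} :=
  (if w is x :: w' then
     chain_poly lo w' +
     (if (lo <= x)%N then 'X * (1 + chain_poly x.+1 w') else 0)
   else 0)%R.

(** This is sigma m n tau with m = [size v]: for [u] and [v] on initial intervals, the letters of
    [v] are the lowest, then m, then the shifted [u], then n. *)
Definition motzkin_join (u v : seq nat) : seq nat :=
  map (addn (size v).+1) u ++ size v :: (size u + size v).+1 :: v.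

Lemma motzkin_wordP w : reflect
  ((forall i j k, (i < j)%N -> (j < k)%N -> (k < size w)%N ->
      ~~ (nth 0 w i < nth 0 w k < nth 0 w j)%N) /\
   (forall i j, (i < j)%N -> (j.+1 < size w)%N ->
      ~~ (nth 0 w i < nth 0 w j < nth 0 w j.+1)%N))
  (motzkin_word w).
Proof.
elim: w => [|a w IH] /=; first by constructor; split.
apply: (iffP and3P) => [[/(pairwiseP 0) pw /(sortedP 0) sw /IH[m1 m2]]|[m1 m2]].
  split=> [[|i] [|j] [|k]|[|i] [|j]] //=.
  - by move=> _ jk kw; apply: pw; rewrite ?inE //; lia.
  - by move=> ? ? ?; apply: m1.
  - by move=> _ ?; apply: sw.
  - by move=> ? ?; apply: m2.
split.
- by apply/(pairwiseP 0) => j k; rewrite !inE => _ kw jk; apply: (m1 0 j.+1 k.+1).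
- by apply/(sortedP 0) => j jw; apply: (m2 0 j.+1).
apply/IH; split=> [i j k ? ? ?|i j ? ?]; first exact: (m1 i.+1 j.+1 k.+1).
exact: (m2 i.+1 j.+1).
Qed.

Lemma motzkin_word_map c w : motzkin_word (map (addn c) w) = motzkin_word w.
Proof.
elim: w => //= a w ->; rewrite pairwise_map sorted_map.
congr [&& _, _ & _]; first by apply: eq_pairwise => x y /=; rewrite !ltn_add2l.
by apply: eq_sorted => x y /=; rewrite !ltn_add2l.
Qed.

Lemma below_pattern_free a v : all (gtn a) v ->
  pairwise (fun y z => ~~ (a < z < y)) v /\ sorted (fun y z => ~~ (a < y < z)) v.
Proof.
move=> /allP va; split.
  apply/(pairwiseP 0) => i j _; rewrite inE => jv _.
  by have := va _ (mem_nth 0 jv); rewrite /=; lia.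
by apply/(sortedP 0) => i iv; have := va _ (mem_nth 0 iv); rewrite /=; lia.
Qed.

Lemma motzkin_word_top N v : all (gtn N) v ->
  motzkin_word (N :: v) = motzkin_word v.
Proof. by move=> /below_pattern_free[/= -> ->]. Qed.

(** No pattern straddles the blocks: [v] lies below all that precedes it, [N] is maximal, and the
    one new ascent, from [m] to [N], has only letters above [m] on its left. *)
Lemma motzkin_word_cat u m N v :
    all (fun x => m < x < N) u -> m < N -> all (gtn m) v ->
  motzkin_word (u ++ m :: N :: v) = motzkin_word u && motzkin_word v.
Proof.
move=> uP mN vm.
have vN : all (gtn N) v by apply: sub_all vm => x /=; lia.
elim: u uP => [_|a u IH /= /andP[aP uP]].
  have [p s] := below_pattern_free vm.
  have [pN sN] := below_pattern_free vN.
  rewrite /= p pN sN andbT; case: motzkin_word; rewrite ?andbF ?andbT //.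
  apply/andP; split; first by apply: sub_all vm => x /=; lia.
  by case: v s vm {vN p pN sN} => //= b v -> /andP[bm _]; rewrite andbT; lia.
have va : all (gtn a) v by apply: sub_all vm => x /=; lia.
have [p s] := below_pattern_free va.
rewrite IH // !andbA; congr (_ && _); congr (_ && _); congr (_ && _).
  rewrite pairwise_cat /= p andbT andbC; case: pairwise => //=; apply/idP.
  rewrite (_ : ~~ (a < N < m)) /= -?andbA; last lia.
  apply/and3P; split.
  - by apply: sub_all va => x /=; lia.
  - by apply: sub_all va => x /=; lia.
  - apply/allrelP => x y xu; rewrite !inE => /or3P[/eqP->|/eqP->|yv].
    + lia.
    + by have := allP uP _ xu; lia.
    + by have := allP va _ yv; rewrite /=; lia.
(* Apart from those inside [v], the only ascent here is from [m] to [N], and [a] lies above [m]. *)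
have pv : path (fun b c => ~~ (a < b < c)) m (N :: v).
  case: v s va {vN vm IH p} => [|b v] /= s va; first by apply/andP; split=> //; lia.
  by rewrite s; apply/and3P; split=> //; move: va => /andP[? _]; lia.
case: u uP {IH} => [|b u] uP; first exact: pv.
rewrite [LHS]/= cat_path [path _ (last _ _) _]/=.
move: pv => /= ->; rewrite andbT andbC.
by rewrite (_ : ~~ _ = true) //; lia.
Qed.

Lemma motzkin_word_cat_left u v : motzkin_word (u ++ v) -> motzkin_word u.
Proof.
elim: u => //= a u IH; rewrite pairwise_cat => /and3P[/and3P[_ -> _] + /IH->].
by case: u {IH} => //= b u; rewrite cat_path => /andP[->].
Qed.

Lemma motzkin_word_cat_right u v : motzkin_word (u ++ v) -> motzkin_word v.
Proof. by elim: u => //= a u IH /and3P[_ _ /IH]. Qed.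

(** A letter x of [u] below a letter z of [v] would make x [N] z a 132, and a letter of [u'] below
    [m] would stand to the left of the ascent from [m] to [N]. Distinctness makes both inequalities
    strict. *)
Lemma motzkin_word_max (u v : seq nat) (N : nat) : uniq (u ++ N :: v) ->
    all (gtn N) u -> all (gtn N) v -> motzkin_word (u ++ N :: v) ->
  allrel ltn v u /\ forall m u', u = rcons u' m -> all (ltn m) u'.
Proof.
move=> + + vN; elim: u => [|a u IH]; first by split=> [|m []] //; rewrite allrel0r.
move=> /= /andP[]; rewrite mem_cat inE !negb_or => /and3P[au aN av] uU.
move=> /andP[aN' uN] /and3P[p s mw].
have [vu lu] := IH uU uN mw; split.
  rewrite allrel_consr vu andbT; apply/allP => z zv /=.
  move: p; rewrite pairwise_cat => /and3P[_ _ /= /andP[/allP/(_ z zv) + _]].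
  by have := memPn av z zv; have := allP vN z zv; move: aN' => /=; lia.
move=> m [|a' u'] //= [<- E]; rewrite (lu _ _ E) andbT.
have mN : m < N by apply: (allP uN); rewrite E mem_rcons inE eqxx.
have am : a != m by apply: contra au => /eqP->; rewrite E mem_rcons inE eqxx.
suff: ~~ (a < m < N) by lia.
move: s; rewrite E cat_rcons; case: (u') => [|b t] /=; first by case/andP.
by rewrite cat_path => /andP[_ /= /and3P[_]].
Qed.

(** Sorted [v] followed by sorted [u] is a sorted rearrangement of the interval, hence the interval
    itself, cut after [size v] entries. *)
Lemma perm_cat_iota a (u v : seq nat) : allrel ltn v u ->
  perm_eq (u ++ v) (iota a (size u + size v)) ->
  perm_eq v (iota a (size v)) /\ perm_eq u (iota (a + size v) (size u)).
Proof.
move=> vu uvP.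
have E : sort leq v ++ sort leq u = iota a (size v + size u).
  apply: (sorted_eq leq_trans anti_leq).
  - rewrite sorted_pairwise; last exact: leq_trans.
    rewrite pairwise_cat -!sorted_pairwise; try exact: leq_trans.
    rewrite !sort_sorted ?andbT; try exact: leq_total.
    apply/allrelP => x y; rewrite !mem_sort => xv yu.
    exact/ltnW/(allrelP vu).
  - exact: iota_sorted.
  rewrite addnC; apply: perm_trans uvP; rewrite perm_catC.
  by apply: perm_cat; rewrite perm_sort.
move/eqP: E; rewrite iotaD eqseq_cat ?size_sort ?size_iota //.
by move=> /andP[/eqP <- /eqP <-]; rewrite ![perm_eq _ (sort _ _)]perm_sym !perm_sort.
Qed.

Lemma perm_motzkin_join (u v : seq nat) :
    perm_eq u (iota 0 (size u)) -> perm_eq v (iota 0 (size v)) ->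
  perm_eq (motzkin_join u v) (iota 0 (size u + size v).+2).
Proof.
move=> pu pv; have -> : iota 0 (size u + size v).+2 = iota 0 (size v) ++
    size v :: map (addn (size v).+1) (iota 0 (size u)) ++ [:: (size u + size v).+1].
  rewrite -iotaDl addn0 -cat_cons -[_ :: iota _ _]/(iota (size v) (size u).+1).
  by rewrite catA -iotaD addnS addnC -[(_ + _).+2]addn1 iotaD.
(* Multisets are compared by counting the letters that satisfy an arbitrary predicate [P]. *)
rewrite /motzkin_join; apply/seq.permP => P; rewrite !(count_cat, count_map) /=.
rewrite !(count_cat, count_map) /= (seq.permP pu) (seq.permP pv).
move: (count P _) (count _ _) (P _ : nat) (P _ : nat) => a b c d; lia.
Qed.

(** The word is cut at its largest letter [n]. If something precedes [n], its last letter m is the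
    least of that prefix, and the prefix lies above what follows [n]. *)
Lemma motzkin_joinP n (w : seq nat) : perm_eq w (iota 0 n.+1) && motzkin_word w <->
  (exists2 v : seq nat, perm_eq v (iota 0 n) && motzkin_word v & w = n :: v) \/
  (exists u v : seq nat, [/\ (size u + size v).+1 = n,
     perm_eq u (iota 0 (size u)) && motzkin_word u,
     perm_eq v (iota 0 (size v)) && motzkin_word v & w = motzkin_join u v]).
Proof.
split.
  move=> /andP[pw mw].
  have sw : size w = n.+1 by rewrite (perm_size pw) size_iota.
  have uw : uniq w by rewrite (perm_uniq pw) iota_uniq.
  have nw : n \in w by rewrite (perm_mem pw) mem_iota add0n ltnSn.
  have wn x : x \in w -> x <= n by rewrite (perm_mem pw) mem_iota add0n ltnS.
  case/splitPr: nw uw wn sw pw mw => u v uw wn sw pw mw.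
  move: (uw); rewrite cat_uniq /= negb_or => /and4P[_ /andP[nu _] nv _].
  have un : all (gtn n) u.
    apply/allP => x xu /=; rewrite ltn_neqAle (memPn nu) // wn //.
    by rewrite mem_cat xu.
  have vn : all (gtn n) v.
    apply/allP => x xv /=; rewrite ltn_neqAle (memPn nv) // wn //.
    by rewrite mem_cat inE xv !orbT.
  have [vu um] := motzkin_word_max uw un vn mw.
  have suv : size u + size v = n by move: sw; rewrite size_cat /=; lia.
  have pn : perm_eq (u ++ v) (iota 0 n).
    rewrite -(perm_cons n) -cat1s perm_catCA.
    by rewrite (permPl pw) -[n.+1]addn1 iotaD perm_catC.
  rewrite -suv in pn; have [pv pu] := perm_cat_iota vu pn.
  have mv : motzkin_word v by move: mw; rewrite -cat_rcons => /motzkin_word_cat_right.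
  case/lastP: u => [|u m] in uw wn sw pw mw nu un vu um suv pn pu *.
    by left; exists v; rewrite //= mv -suv pv.
  right.
  (* As [m] lies below the rest of the prefix, [perm_cat_iota] applies a second time and forces [m]
     to be [size v]. *)
  have mu : allrel ltn [:: m] u by rewrite allrel1l (um _ u).
  move: pu; rewrite -cats1 size_cat => /(perm_cat_iota mu)[/perm_small_eq pm pu].
  have {pm}[mE] : [:: m] = [:: size v] by apply: pm.
  (* Truncated subtraction loses nothing, since every letter of [u] exceeds [m = size v]. *)
  pose u0 := map (subn^~ (size v).+1) u.
  have uE : u = map (addn (size v).+1) u0.
    rewrite /u0 -map_comp map_id_in // => x xu /=.
    by rewrite subnKC //; have := allP (um _ _ erefl) _ xu; rewrite mE.
  have su : size u0 = size u by rewrite size_map.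
  exists u0, v; rewrite mv pv su andbT; split=> //.
  - by rewrite -suv size_rcons addSn.
  - apply/andP; split.
      apply: (perm_map_inj (@addnI (size v).+1)).
      by rewrite -uE -iotaDl addn0 -addn1.
    rewrite -(motzkin_word_map (size v).+1) -uE; move: mw.
    by rewrite cat_rcons => /motzkin_word_cat_left.
  - by rewrite /motzkin_join -uE -catA /= mE su -suv size_rcons.
case=> [[v /andP[pv mv] ->]|[u [v [<- /andP[pu mu] /andP[pv mv] ->]]]].
  rewrite motzkin_word_top ?mv ?andbT.
    by rewrite -addn1 iotaD /= perm_sym -cat1s perm_catC perm_sym /= perm_cons.
  by apply/allP => x; rewrite (perm_mem pv) mem_iota.
rewrite perm_motzkin_join // motzkin_word_cat ?motzkin_word_map ?mu ?mv //.
- by apply/allP => x /mapP[y]; rewrite (perm_mem pu) mem_iota => /= yu ->; lia.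
- by lia.
- by apply/allP => x; rewrite (perm_mem pv) mem_iota.
Qed.

(** * Enumeration of the Motzkin words of a given length *)

Definition motzkin_words n : seq (seq nat) :=
  [seq w <- permutations (iota 0 n) | motzkin_word w].

Lemma mem_motzkin_words n (w : seq nat) :
  (w \in motzkin_words n) = perm_eq w (iota 0 n) && motzkin_word w.
Proof. by rewrite mem_filter mem_permutations andbC. Qed.

Lemma size_motzkin_words n (w : seq nat) : w \in motzkin_words n -> size w = n.
Proof.
by rewrite mem_motzkin_words => /andP[/perm_size]; rewrite size_iota.
Qed.

Lemma motzkin_words_lt n (w : seq nat) : w \in motzkin_words n -> all (gtn n) w.
Proof.
rewrite mem_motzkin_words => /andP[pw _].
by apply/allP => x; rewrite (perm_mem pw) mem_iota.
Qed.

Lemma motzkin_words_uniq n : uniq (motzkin_words n).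
Proof. exact/filter_uniq/permutations_uniq. Qed.

Lemma motzkin_words0 : motzkin_words 0 = [:: [::]].
Proof. by []. Qed.

(** The first [N] marks the cut, so [index] recovers the length of the prefix. Hence the
    decomposition at the largest letter is unique. *)
Lemma cat_cons_inj (N : nat) (u v u' v' : seq nat) : N \notin u -> N \notin u' ->
  u ++ N :: v = u' ++ N :: v' -> u = u' /\ v = v'.
Proof.
move=> Nu Nu' E; have /eqP := congr1 (index N) E.
rewrite !index_cat (negbTE Nu) (negbTE Nu') /= eqxx !addn0 => /eqP su.
by move/eqP: E; rewrite eqseq_cat // => /andP[/eqP-> /eqP[->]].
Qed.

(** Here [i] is the length of sigma; m and n take two places, so tau has length [n.-1 - i].
    Membership comes from [motzkin_joinP] and the absence of repetitions from [cat_cons_inj]. *)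
Lemma motzkin_words_rec n : perm_eq (motzkin_words n.+1)
  ([seq n :: v | v <- motzkin_words n] ++
   [seq motzkin_join p.1 p.2 | i <- iota 0 n,
      p <- [seq (u, v) | u <- motzkin_words i, v <- motzkin_words (n.-1 - i)]]).
Proof.
pose pairs i := [seq (u, v) | u <- motzkin_words i, v <- motzkin_words (n.-1 - i)].
have mem_pairs (i : nat) (p : seq nat * seq nat) : i \in iota 0 n -> p \in pairs i ->
    [/\ p.1 \in motzkin_words i, p.2 \in motzkin_words (n.-1 - i),
      size p.1 = i & (size p.1 + size p.2).+1 = n].
  rewrite mem_iota => /= i_n /allpairsP[[u v] /= [uM vM ->]] /=; split=> //.
    exact: size_motzkin_words uM.
  by rewrite (size_motzkin_words uM) (size_motzkin_words vM); lia.
apply: uniq_perm; first exact: motzkin_words_uniq.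
  rewrite cat_uniq map_inj_uniq ?motzkin_words_uniq => [|u v [->]] //=.
  have joinE (p : seq nat * seq nat) (i : nat) : i \in iota 0 n -> p \in pairs i ->
    exists2 u, motzkin_join p.1 p.2 = rcons u (size p.2) ++ n :: p.2 &
      n \notin rcons u (size p.2).
    move=> iI /(mem_pairs i p iI)[p1 _ s1 sp].
    exists (map (addn (size p.2).+1) p.1); first by rewrite cat_rcons /motzkin_join sp.
    rewrite mem_rcons inE negb_or; apply/andP; split.
      by apply/eqP => /= nE; move: sp; rewrite {1}nE; lia.
    apply/mapP => -[x xp nE]; have := allP (motzkin_words_lt p1) x xp => /=.
    by rewrite -s1; lia.
  apply/andP; split.
    (* In the first family nothing precedes [n], whereas in a join at least m does. *)
    apply/hasPn => w /allpairsPdep[i [p [iI pI ->]]].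
    apply/mapP => -[v vM]; have [u -> nu] := joinE p i iI pI => E.
    have [] := @cat_cons_inj n (rcons u (size p.2)) p.2 [::] v nu _ E => //.
    by case: (u).
  apply: allpairs_uniq_dep; first exact: iota_uniq.
    by move=> i iI; apply: allpairs_uniq => [||[? ?] [? ?] _ _ [-> ->]];
      rewrite ?motzkin_words_uniq.
  move=> _ _ /allpairsPdep[i [p [iI pI ->]]] /allpairsPdep[i' [p' [iI' pI' ->]]] /=.
  have [_ _ si sp] := mem_pairs i p iI pI.
  have [_ _ si' sp'] := mem_pairs i' p' iI' pI'.
  have [u E nu] := joinE p i iI pI; have [u' E' nu'] := joinE p' i' iI' pI'.
  move=> EE; move: (EE); rewrite E E' => /(cat_cons_inj nu nu')[_ E2].
  have E1 : p.1 = p'.1.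
    apply: (inj_map (@addnI (size p.2).+1)).
    move: EE; rewrite /motzkin_join E2 => /eqP; rewrite eqseq_cat.
      by move=> /andP[/eqP].
    by rewrite !size_map; move: sp sp'; rewrite E2; lia.
  have -> : p = p' by rewrite [LHS]surjective_pairing E1 E2 -surjective_pairing.
  by rewrite -si -si' E1.
move=> w; rewrite mem_motzkin_words mem_cat; apply/idP/orP.
  case/motzkin_joinP => [[v pv ->]|[u [v [sn pu pv ->]]]].
    by left; apply/mapP; exists v; rewrite ?mem_motzkin_words.
  right; apply/allpairsPdep; exists (size u), (u, v); split=> //.
    by rewrite mem_iota; lia.
  apply/allpairsP; exists (u, v); rewrite /= !mem_motzkin_words pu.
  by rewrite (_ : n.-1 - size u = size v) //; lia.
move=> H; apply/motzkin_joinP; case: H => [/mapP[v vM ->]|].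
  by left; exists v; rewrite -?mem_motzkin_words.
move=> /allpairsPdep[i [p [iI pI ->]]].
have [p1 p2 s1 s2] := mem_pairs i p iI pI; right; exists p.1, p.2; split=> //.
  by rewrite -mem_motzkin_words s1.
by rewrite -mem_motzkin_words (size_motzkin_words p2).
Qed.

Local Open Scope ring_scope.

(** * Chain polynomials along the decomposition *)

Lemma chain_poly_large lo v : all (gtn lo) v -> chain_poly lo v = 0.
Proof.
by elim: v => //= x v IH /andP[xlo /IH->]; rewrite leqNgt xlo addr0.
Qed.

(** When [lo] is below [c], truncation gives the threshold 0, which is right because every shifted
    letter is at least [c]. *)
Lemma chain_poly_map c lo w :
  chain_poly lo (map (addn c) w) = chain_poly (lo - c)%N w.
Proof.
elim: w lo => //= x w IH lo; rewrite !IH leq_subLR.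
by rewrite -addnS addKn.
Qed.

(** No increasing subsequence passes from [u] to [v]. *)
Lemma chain_poly_cat lo u v : allrel ltn v u ->
  chain_poly lo (u ++ v) = chain_poly lo u + chain_poly lo v.
Proof.
elim: u lo => [|x u IH] lo /=; first by rewrite add0r.
rewrite allrel_consr => /andP[vx vu]; rewrite !IH // (@chain_poly_large x.+1 v).
  by rewrite addr0 addrAC.
by apply: sub_all vx => y /=; apply: ltnW.
Qed.

(** A chain starting in [u] cannot continue with [m] but may be extended by [N], whence the factor
    [1 + 'X]. The remaining chains are [N] and, if [lo] allows, [m] and [m N]. *)
Lemma chain_poly_rcons2 lo u m N :
    all (fun x => m < x < N)%N u -> (m < N)%N -> (lo <= N)%N ->
  chain_poly lo (u ++ [:: m; N]) = (1 + 'X) * chain_poly lo u +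
    ((if (lo <= m)%N then 'X * (1 + 'X) else 0) + 'X).
Proof.
move=> + mN; elim: u lo => [|x u IH] lo.
  by move=> _ lN; rewrite /= lN mN mulr0 !add0r addr0 mulr1 addrC.
move=> /= /andP[/andP[mx xN] uP] lN.
rewrite !IH // ltnNge (ltnW mx) /= add0r.
case: (lo <= x)%N; last by rewrite !addr0.
set c := if _ then _ else _; ring.
Qed.

Lemma chain_poly_top N v : all (gtn N) v ->
  chain_poly 0 (N :: v) = 'X + chain_poly 0 v.
Proof.
move=> vN; rewrite /= (@chain_poly_large N.+1 v) ?addr0 ?mulr1 1?addrC //.
by apply: sub_all vN => x /ltnW.
Qed.

Lemma chain_poly_join u v : all (gtn (size u)) u -> all (gtn (size v)) v ->
  chain_poly 0 (motzkin_join u v) =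
  (1 + 'X) * chain_poly 0 u + ('X * (1 + 'X) + 'X) + chain_poly 0 v.
Proof.
move=> uP vP; rewrite /motzkin_join -[_ :: _ :: v]/([:: _; _] ++ v) catA.
rewrite chain_poly_cat.
  rewrite chain_poly_rcons2 ?chain_poly_map //; last lia.
  apply/allP => _ /mapP[x /(allP uP) /= xu ->]; lia.
apply/allrelP => x y /(allP vP) /= xv; rewrite mem_cat !inE.
by case/or3P => [/mapP[z _ ->]|/eqP->|/eqP->]; lia.
Qed.

(** * Order of vanishing and the functional equation *)

(** Storing exponents as coefficients turns products of monomials into sums of polynomials, and the
    effect of appending m n to sigma into multiplication by [1 + 'X]. *)
Definition fps_monomial (p : {poly nat}) : fps := \prod_(i < size p) 'x_i ^+ (p`_i)%R.

Lemma fps_monomial_widen (p : {poly nat}) N : (size p <= N)%N ->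
  fps_monomial p = \prod_(0 <= i < N) 'x_i ^+ (p`_i)%R.
Proof.
move=> pN; rewrite /fps_monomial -(big_mkord xpredT (fun i => 'x_i ^+ (p`_i)%R)).
rewrite (big_cat_nat (leq0n _) pN) //=.
rewrite [X in _ * X]big_nat_cond [X in _ * X]big1 ?mulr1 // => i.
by rewrite andbT => /andP[pi _]; rewrite nth_default.
Qed.

Lemma fps_monomialD p q : fps_monomial (p + q) = fps_monomial p * fps_monomial q.
Proof.
pose N := maxn (size p) (size q).
rewrite (@fps_monomial_widen (p + q) N) ?size_polyD //.
rewrite (@fps_monomial_widen p N) ?leq_maxl // (@fps_monomial_widen q N) ?leq_maxr //.
by rewrite -big_split; apply: eq_bigr => i _; rewrite coefD exprD.
Qed.

Lemma fps_monomial0 : fps_monomial 0 = 1.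
Proof. by rewrite /fps_monomial size_poly0 big_ord0. Qed.

Lemma coef_1DX_exp k i : ((1 + 'X : {poly nat}) ^+ k)`_i = 'C(k, i).
Proof.
elim: k i => [|k IH] i; first by rewrite expr0 coef1 bin0n; case: eqP.
rewrite exprS mulrDl mul1r coefD coefXM IH.
by case: i => [|i]; rewrite /= ?bin0 ?addr0 // binS IH.
Qed.

Lemma fps_monomial_from1 (p : {poly nat}) N : p`_0 = 0%N -> (size p <= N.+1)%N ->
  fps_monomial p = \prod_(1 <= i < N.+1) 'x_i ^+ (p`_i)%R.
Proof.
move=> p0 /fps_monomial_widen->; rewrite (big_ltn (ltn0Sn N)) -[RHS]mul1r.
by congr (_ * _); rewrite p0 expr0.
Qed.

(** This is the weight, at level [k], of a leading letter n. *)
Lemma cf_aE k : cf_a k.+1 = fps_monomial ('X * (1 + 'X) ^+ k).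
Proof.
rewrite (@fps_monomial_from1 _ k.+1) ?coefXM //; last first.
  by apply/leq_sizeP => -[|i] // ki; rewrite coefXM coef_1DX_exp bin_small.
apply: eq_big_nat => -[|i] // _; congr (_ ^+ _).
by rewrite coefXM coef_1DX_exp.
Qed.

(** This is the weight, at level [k], of the pair m n: the last factor is its contribution in
    [chain_poly_join]. *)
Lemma cf_bE k : cf_b k.+1 = fps_monomial ((1 + 'X) ^+ k * ('X * (1 + 'X) + 'X)).
Proof.
have -> : (1 + 'X) ^+ k * ('X * (1 + 'X) + 'X) =
  'X * (1 + 'X) ^+ k.+1 + 'X * (1 + 'X) ^+ k :> {poly nat} by rewrite exprS; ring.
rewrite (@fps_monomial_from1 _ k.+2) ?coefD ?coefXM //; last first.
  apply/leq_sizeP => -[|i] // ki.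
  by rewrite coefD !coefXM !coef_1DX_exp !bin_small //=; lia.
apply: eq_big_nat => -[|i] // _; congr (_ ^+ _).
by rewrite coefD !coefXM !coef_1DX_exp.
Qed.

(** The part of F_k that comes from words of length [n]. *)
Definition motzkin_gf k n : fps :=
  \sum_(w <- motzkin_words n) fps_monomial ((1 + 'X) ^+ k * chain_poly 0 w).

Lemma motzkin_gf0 k : motzkin_gf k 0 = 1.
Proof. by rewrite /motzkin_gf motzkin_words0 big_seq1 /= mulr0 fps_monomial0. Qed.

(** The factor [1 + 'X] that sigma acquires in a join raises its level to [k.+1], while tau stays at
    level [k]. *)
Lemma motzkin_gf_rec k n : motzkin_gf k n.+1 =
  cf_a k.+1 * motzkin_gf k n +
  cf_b k.+1 * \sum_(0 <= i < n) motzkin_gf k.+1 i * motzkin_gf k (n.-1 - i).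
Proof.
rewrite /motzkin_gf (perm_big _ (motzkin_words_rec n)) big_cat; congr (_ + _).
  rewrite big_map mulr_sumr; apply: eq_big_seq => v /motzkin_words_lt vn.
  by rewrite chain_poly_top // mulrDr fps_monomialD cf_aE [_ * 'X]mulrC.
rewrite big_allpairs_dep /index_iota subn0 mulr_sumr; apply: eq_big_seq => i iI.
rewrite big_allpairs big_distrl mulr_sumr; apply: eq_big_seq => u uM.
rewrite /= !mulr_sumr; apply: eq_big_seq => v vM.
have := motzkin_words_lt uM; rewrite -{1}(size_motzkin_words uM) => ul.
have := motzkin_words_lt vM; rewrite -{1}(size_motzkin_words vM) => vl.
rewrite chain_poly_join // cf_bE 2!mulrDr !fps_monomialD mulrA -exprSr.
by rewrite -mulrA mulrCA.
Qed.

(** These series form an ideal for each [d], so errors can be added and multiplied by anything; an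
    error in the [n]-th ideal at every stage [n] gives coefficientwise convergence. *)
Definition order_ge (d : nat) (f : fps) := forall m, (mdeg m < d)%N -> fcoef f m = 0.

Lemma order_geW d e f : (e <= d)%N -> order_ge d f -> order_ge e f.
Proof. by move=> ed df m me; apply/df/(leq_trans me). Qed.

Lemma order_geD d f g : order_ge d f -> order_ge d g -> order_ge d (f + g).
Proof. by move=> df dg m md; rewrite fcoefD df ?dg ?addr0. Qed.

Lemma order_geN d f : order_ge d f -> order_ge d (- f).
Proof. by move=> df m md; rewrite fcoefN df ?oppr0. Qed.

Lemma order_ge_sum d I (r : seq I) (P : pred I) (F : I -> fps) :
  (forall i, P i -> order_ge d (F i)) -> order_ge d (\sum_(i <- r | P i) F i).
Proof. by move=> dF m md; rewrite fcoef_sum big1 // => i /dF; apply. Qed.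

Lemma order_geM d e f g : order_ge d f -> order_ge e g -> order_ge (d + e) (f * g).
Proof.
move=> df eg m md; rewrite fcoefM big1_seq // => -[a b] /=.
rewrite in_factorizations /= => /eqP ab.
have [ad|ad] := ltnP (mdeg a) d; first by rewrite df ?mul0r.
rewrite eg ?mulr0 // -(ltn_add2l (mdeg a)) -mdegM ab (leq_trans md) //.
by rewrite leq_add2r.
Qed.

Lemma order_geMr d f g : order_ge d f -> order_ge d (f * g).
Proof. by move=> df; rewrite -[d]addn0; apply: order_geM. Qed.

Lemma order_ge_var j : order_ge 1 'x_j.
Proof.
move=> m; rewrite ltnS leqn0 mdeg_eq0 fcoef_var => /eqP->.
by rewrite eq_sym cm1_eq1.
Qed.

Lemma order_ge_cf_a n : (0 < n)%N -> order_ge 1 (cf_a n).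
Proof.
case: n => // n _; rewrite /cf_a (big_ltn (isT : (1 < n.+2)%N)); apply: order_geMr.
have -> : 'C(n.+1.-1, 1.-1) = 1%N by exact: bin0.
by rewrite expr1; apply: order_ge_var.
Qed.

Lemma order_ge_cf_b n : (0 < n)%N -> order_ge 2 (cf_b n).
Proof.
case: n => // n _; rewrite /cf_b (big_ltn (isT : (1 < n.+3)%N)); apply: order_geMr.
have -> : ('C(n.+1, 1.-1) + 'C(n.+1.-1, 1.-1) = 2)%N by rewrite !bin0.
by rewrite expr2; apply: (@order_geM 1 1); apply: order_ge_var.
Qed.

(** By the recurrence: a leading n brings order 1 through [cf_a], and the pair m n brings order 2
    through [cf_b]. *)
Lemma order_ge_motzkin_gf k n : order_ge n (motzkin_gf k n).
Proof.
elim/ltn_ind: n k => -[|n] IH k //; rewrite motzkin_gf_rec; apply: order_geD.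
  by rewrite -add1n; apply: order_geM; [apply: order_ge_cf_a|apply: IH].
rewrite mulr_sumr big_nat_cond; apply: order_ge_sum => i /andP[/andP[_ i_n] _].
apply: (@order_geW (2 + (i + (n.-1 - i)))); first by lia.
apply: order_geM; first exact: order_ge_cf_b.
by apply: order_geM; apply: IH; lia.
Qed.

Lemma order_ge_eq f g : (forall d, order_ge d (f - g)) -> f = g.
Proof.
move=> fg; apply: fpsP => m; have := fg (mdeg m).+1 m (ltnSn _).
by rewrite fcoefD fcoefN => /eqP; rewrite subr_eq0 => /eqP.
Qed.

Lemma fps_cvg_order u l : (forall n, order_ge n (u n - l)) -> fps_cvg u l.
Proof.
move=> ul m; exists (mdeg m).+1 => n mn; have /eqP := ul n m mn.
by rewrite fcoefD fcoefN subr_eq0 => /eqP.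
Qed.

(** The infinite sum F_k, defined one coefficient at a time: words longer than the degree of [m] do
    not affect the coefficient of [m]. *)
Definition motzkin_series k : fps :=
  Fps (fun m => fcoef (\sum_(0 <= n < (mdeg m).+1) motzkin_gf k n) m).

Lemma motzkin_seriesE k N :
  order_ge N (\sum_(0 <= n < N) motzkin_gf k n - motzkin_series k).
Proof.
move=> m mN; rewrite fcoefD fcoefN (big_cat_nat (leq0n _) mN) /= fcoefD.
rewrite addrAC subrr add0r big_nat_cond; apply: (order_ge_sum (d := (mdeg m).+1)) => //.
move=> i /andP[/andP[mi _] _]; apply: order_geW mi _; exact: order_ge_motzkin_gf.
Qed.

(** Both sides run over the pairs with i + j + 1 < N, where n = i + j + 1. *)
Lemma sum_nat_triangle (V : nmodType) (f : nat -> nat -> V) N :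
  \sum_(0 <= n < N) \sum_(0 <= i < n) f i (n.-1 - i)%N =
  \sum_(0 <= i < N) \sum_(0 <= j < N - i.+1) f i j.
Proof.
transitivity (\sum_(0 <= n < N) \sum_(0 <= i < N | (i < n)%N) f i (n.-1 - i)%N).
  apply: eq_big_nat => n /andP[_ nN]; rewrite (big_nat_widen 0 n N) ?(ltnW nN) //.
rewrite (exchange_big_dep_nat xpredT) //=; apply: eq_big_nat => i _.
rewrite -(big_nat_widenl i.+1 0 N xpredT) // -{1}[i.+1]add0n big_addn.
by apply: eq_big_nat => j _; congr (f _ _); lia.
Qed.

(** Removing the triangle from the square of indices leaves only pairs with i + j at least [N]. *)
Lemma motzkin_gf_conv k N : order_ge N
  ((\sum_(0 <= i < N.+1) motzkin_gf k.+1 i) * (\sum_(0 <= j < N.+1) motzkin_gf k j) -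
   \sum_(0 <= n < N.+1) \sum_(0 <= i < n) motzkin_gf k.+1 i * motzkin_gf k (n.-1 - i)).
Proof.
rewrite (sum_nat_triangle (fun i j => motzkin_gf k.+1 i * motzkin_gf k j)).
rewrite mulr_suml -sumrB big_nat_cond.
apply: order_ge_sum => i /andP[/andP[_ iN] _]; rewrite mulr_sumr.
rewrite (big_cat_nat (leq0n _) (leq_subr i.+1 N.+1)) /= addrAC subrr add0r big_nat_cond.
apply: order_ge_sum => j /andP[/andP[ij _] _].
apply: (@order_geW (i + j)); first by lia.
by apply: order_geM; apply: order_ge_motzkin_gf.
Qed.

Lemma motzkin_series_eq k : motzkin_series k =
  1 + cf_a k.+1 * motzkin_series k +
  cf_b k.+1 * (motzkin_series k.+1 * motzkin_series k).
Proof.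
apply: order_ge_eq => N.
pose S j : fps := \sum_(0 <= n < N.+1) motzkin_gf j n.
pose C : fps := \sum_(0 <= n < N.+1) \sum_(0 <= i < n)
  motzkin_gf k.+1 i * motzkin_gf k (n.-1 - i).
have Sk : \sum_(0 <= n < N.+2) motzkin_gf k n =
    1 + cf_a k.+1 * S k + cf_b k.+1 * C.
  rewrite big_nat_recl // motzkin_gf0 !mulr_sumr -addrA -big_split.
  by congr (_ + _); apply: eq_bigr => n _; rewrite motzkin_gf_rec.
have Fk := order_geW (leqnSn N) (@motzkin_seriesE k N.+1).
have Fk1 := order_geW (leqnSn N) (@motzkin_seriesE k.+1 N.+1).
have FkS := order_geW (leqW (leqnSn N)) (@motzkin_seriesE k N.+2).
have CE := @motzkin_gf_conv k N.
rewrite Sk in FkS; rewrite -/(S k) in Fk; rewrite -/(S k.+1) in Fk1.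
rewrite -/C -/(S k) -/(S k.+1) in CE.
set F := motzkin_series k in Fk FkS *; set G := motzkin_series k.+1 in Fk1 *.
set a := cf_a _ in FkS *; set b := cf_b _ in FkS *.
(* The defect of the equation is a combination of the truncation errors of [F] and [G] and the
   convolution error, all of order at least [N]. *)
have -> : F - (1 + a * F + b * (G * F)) = - (1 + a * S k + b * C - F) +
   (S k - F) * a - (S k.+1 * S k - C) * b +
  ((S k.+1 - G) * (S k * b) + (S k - F) * (G * b)) by ring.
apply: order_geD; first apply: order_geD; first apply: order_geD.
- exact: order_geN.
- exact: order_geMr.
- exact/order_geN/order_geMr.
by apply: order_geD; apply: order_geMr.
Qed.

(** F_i is the inverse of 1 - a_(i+1) - b_(i+1) F_(i+1), and the denominator of the convergent has
    the same shape with a shorter convergent for F_(i+1). The error thus passes outwards multiplied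
    by b_(i+1). *)
Lemma jfrac_convergent_order i k : order_ge k.+1
  ((jfrac_den cf_a cf_b i.+1 k)^-1 - motzkin_series i).
Proof.
have fixpoint j : motzkin_series j *
    (1 - cf_a j.+1 - cf_b j.+1 * motzkin_series j.+1) = 1.
  have E := motzkin_series_eq j.
  have -> : motzkin_series j * (1 - cf_a j.+1 - cf_b j.+1 * motzkin_series j.+1) =
    motzkin_series j - cf_a j.+1 * motzkin_series j -
    cf_b j.+1 * (motzkin_series j.+1 * motzkin_series j) by ring.
  by rewrite {1}E addrAC addrK addrK.
have err j d f : d \is a GRing.unit -> order_ge f (motzkin_series j * d - 1) ->
    order_ge f (d^-1 - motzkin_series j).
  move=> dU df; have -> : d^-1 - motzkin_series j = - (motzkin_series j * d - 1) * d^-1.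
    by rewrite mulNr mulrBl mulrK // mul1r opprB.
  exact/order_geMr/order_geN.
elim: k i => [|k IH] i; apply: err; try exact: cf_den_unit.
  (* Without an inner fraction, the defect is F_i b_(i+1) F_(i+1). *)
  rewrite -[X in _ - X](fixpoint i) -mulrBr /= subr0 opprB addrC subrK mulrCA.
  exact/order_geMr/(order_geW _ (@order_ge_cf_b i.+1 isT)).
rewrite -[X in _ - X](fixpoint i) /=.
set D := (jfrac_den _ _ _ _)^-1; set F := motzkin_series _; set G := motzkin_series _.
rewrite (_ : _ - _ = - (cf_b i.+1 * (D - G) * F)); last ring.
apply/order_geN/order_geMr; rewrite -[k.+2]add1n; apply: order_geM.
  exact: order_geW (@order_ge_cf_b i.+1 isT).
exact: IH.
Qed.

Lemma jfrac_convergent_cvg : fps_cvg (jfrac_convergent cf_a cf_b) (motzkin_series 0).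
Proof.
apply: fps_cvg_order => n; rewrite /jfrac_convergent div1r.
exact: order_geW (leqnSn n) (@jfrac_convergent_order 0 n).
Qed.

(** * Counting increasing subsequences *)

Local Open Scope nat_scope.

(** The recursion copies that of [chain_poly], but lists positions and compares their values under
    [f]. *)
Fixpoint increasing_subseqs (T : eqType) (f : T -> nat) (lo j : nat) (l : seq T) :
    seq (seq T) :=
  if l is x :: l' then
    increasing_subseqs f lo j l' ++
    (if j is j'.+1 then
       if lo <= f x then [seq x :: u | u <- increasing_subseqs f (f x).+1 j' l']
       else [::]
     else [::])
  else if j is 0 then [:: [::]] else [::].

Lemma mem_increasing_subseqs (T : eqType) (f : T -> nat) lo j l u :
  (u \in increasing_subseqs f lo j l) =
  [&& size u == j, subseq u l, sorted ltn (map f u) & all (leq lo) (map f u)].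
Proof.
elim: l lo j u => [|x l IH] lo j u /=.
  by case: j u => [|j] [|y u]; rewrite ?inE ?andbF.
rewrite mem_cat IH; case: u => [|y u] /=.
  rewrite sub0seq; case: j {IH} => [|j] //=; case: ifP => // _.
  by apply/negbTE/mapP => -[].
case: j => [|j] //=; rewrite eqSS.
have memc : (y :: u \in (if lo <= f x then
    [seq x :: v | v <- increasing_subseqs f (f x).+1 j l] else [::])) =
    [&& y == x, lo <= f x & u \in increasing_subseqs f (f x).+1 j l].
  case: ifP => [_|]; rewrite ?andbF //; apply/mapP/andP => [[v vF [-> ->]]|[/eqP-> uF]].
    by rewrite eqxx.
  by exists u.
rewrite memc IH (path_sortedE ltn_trans).
case: (eqVneq y x) => [->|_]; last by rewrite orbF.
(* If [u] is not a subsequence of [l], neither is [x :: u], and both disjuncts fail. *)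
have [sub|nsub] := boolP (subseq u l); last first.
  rewrite (_ : subseq (x :: u) l = false) ?andbF ?orbF //.
  by apply/negbTE; apply: contra nsub; apply/subseq_trans/subseq_cons.
have -> : all (leq (f x).+1) (map f u) = all (ltn (f x)) (map f u) by [].
have [lox|_] := leqP lo (f x); last by rewrite /= !andbF.
have [fu|nfu] := boolP (all (ltn (f x)) (map f u)); last by rewrite /= !andbF.
rewrite (_ : all (leq lo) _ = true) ?andbT //=; last first.
  by apply: sub_all fu => z /= /ltnW; apply: leq_trans.
by case: (size u == j); case: sorted; case: subseq.
Qed.

Lemma increasing_subseqs_uniq (T : eqType) (f : T -> nat) lo j l :
  uniq l -> uniq (increasing_subseqs f lo j l).
Proof.
elim: l lo j => [|x l IH] lo [|j] //= /andP[xl ul]; first by rewrite cats0 IH.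
rewrite cat_uniq IH //=; case: ifP => //= _.
rewrite map_inj_uniq => [|u v [->]] //; rewrite IH // andbT.
apply/hasPn => _ /mapP[u uF ->]; rewrite mem_increasing_subseqs.
apply/negP => /and3P[_ /mem_subseq/(_ x) xs _].
by rewrite xs ?mem_head in xl.
Qed.

(** The summand 1 restores the empty subsequence, which [chain_poly] leaves out. *)
Lemma size_increasing_subseqs (T : eqType) (f : T -> nat) lo j l :
  size (increasing_subseqs f lo j l) = ((1 + chain_poly lo (map f l))`_j)%R.
Proof.
elim: l lo j => [|x l IH] lo j /=; first by rewrite addr0 coef1; case: j.
rewrite size_cat IH addrA [RHS]coefD; apply: (congr2 addn) => //.
by case: j => [|j]; case: ifP => _; rewrite ?size_map ?coef0 ?coefXM ?IH.
Qed.

(** A strictly increasing sequence is determined by its set of entries, so [t] is the enumeration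
    filtered by membership in [t]. *)
Lemma sorted_ltn_subseq_enum n (t : seq 'I_n) :
  sorted (fun i j : 'I_n => i < j) t = subseq t (enum 'I_n).
Proof.
have tr : transitive (fun i j : 'I_n => i < j) by move=> ? ? ?; apply: ltn_trans.
have enum_sorted : sorted (fun i j : 'I_n => i < j) (enum 'I_n).
  by have := iota_ltn_sorted 0 n; rewrite -val_enum_ord sorted_map.
apply/idP/idP => [st|/subseq_sorted]; last exact.
rewrite (_ : t = filter (mem t) (enum 'I_n)) ?filter_subseq //.
apply: (irr_sorted_eq tr) => //; first by move=> ?; apply: ltnn.
  exact: sorted_filter.
by move=> i; rewrite mem_filter mem_enum andbT.
Qed.

(** * From permutations to words *)

Definition perm_word n (s : 'S_n) : seq nat := [seq val (s i) | i <- enum 'I_n].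

Lemma size_perm_word n (s : 'S_n) : size (perm_word s) = n.
Proof. by rewrite size_map size_enum_ord. Qed.

Lemma nth_perm_word n (s : 'S_n) (i : 'I_n) : nth 0 (perm_word s) i = s i.
Proof. by rewrite (nth_map i) ?size_enum_ord // nth_ord_enum. Qed.

Lemma occ_incrE n j (s : 'S_n) : occ_incr j s = ((1 + chain_poly 0 (perm_word s))`_j)%R.
Proof.
rewrite -size_increasing_subseqs /occ_incr cardE -(size_map val).
apply/perm_size/uniq_perm.
- by rewrite map_inj_uniq ?enum_uniq //; apply: val_inj.
- exact/increasing_subseqs_uniq/enum_uniq.
move=> u; rewrite mem_increasing_subseqs -sorted_ltn_subseq_enum sorted_map.
rewrite (eq_all (a2 := predT)) // all_predT andbT.
apply/mapP/and3P => [[t]|[/eqP su pu vu]].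
  by rewrite mem_enum inE => /andP[pt vt] ->; rewrite size_tuple.
have su' : size u == j by apply/eqP.
by exists (Tuple su'); rewrite ?mem_enum ?inE /= ?pu.
Qed.

Lemma motzkinE n (s : 'S_n) : motzkin s = motzkin_word (perm_word s).
Proof.
apply/andP/motzkin_wordP => -[].
  move=> /forallP p /forallP q; rewrite size_perm_word.
  split=> [i j k ij jk kn|i j ij jn].
    have jn := ltn_trans jk kn; have in_ := ltn_trans ij jn.
    have /forallP/(_ (Ordinal jn))/forallP/(_ (Ordinal kn)) := p (Ordinal in_).
    by rewrite /= ij jk -!nth_perm_word.
  have jn' := ltn_trans (ltnSn j) jn; have in_ := ltn_trans ij jn'.
  have /forallP/(_ (Ordinal jn'))/forallP/(_ (Ordinal jn)) := q (Ordinal in_).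
  by rewrite /= ij eqxx -!nth_perm_word.
rewrite size_perm_word => p q; split.
  apply/forallP => i; apply/forallP => j; apply/forallP => k.
  by apply/implyP => /andP[ij jk]; rewrite -!nth_perm_word p.
apply/forallP => i; apply/forallP => j; apply/forallP => k.
by apply/implyP => /andP[ij /eqP kj]; rewrite -!nth_perm_word kj q // -kj.
Qed.

Lemma perm_word_inj n : injective (@perm_word n).
Proof.
by move=> s t st; apply/permP => i; apply/val_inj; rewrite /= -!nth_perm_word st.
Qed.

Lemma perm_perm_word n (s : 'S_n) : perm_eq (perm_word s) (iota 0 n).
Proof.
rewrite -val_enum_ord /perm_word (map_comp val s); apply: perm_map.
apply: uniq_perm => [||i]; rewrite ?(map_inj_uniq perm_inj) ?enum_uniq //.
by rewrite mem_enum -[i](permKV s) map_f // mem_enum.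
Qed.

Lemma perm_word_onto n (w : seq nat) :
  perm_eq w (iota 0 n) -> exists s : 'S_n, perm_word s = w.
Proof.
move=> pw; have sw : size w = n by rewrite (perm_size pw) size_iota.
have uw : uniq w by rewrite (perm_uniq pw) iota_uniq.
have wn (i : 'I_n) : nth 0 w i < n.
  have : nth 0 w i \in w by rewrite mem_nth ?sw.
  by rewrite (perm_mem pw) mem_iota.
have f_inj : injective (fun i => Ordinal (wn i)).
  move=> i j [/eqP]; rewrite nth_uniq ?sw // => /eqP; exact: val_inj.
exists (perm f_inj); apply: (@eq_from_nth _ 0); rewrite size_perm_word // => i i_n.
by rewrite -[i]/(val (Ordinal i_n)) nth_perm_word permE.
Qed.

Local Open Scope ring_scope.

Lemma chain_poly_coef0 lo w : (chain_poly lo w)`_0 = 0%N.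
Proof.
elim: w => [|x w IH]; first by rewrite coef0.
by rewrite [chain_poly _ _]/= coefD IH; case: ifP; rewrite ?coefXM ?coef0.
Qed.

Lemma weightE n (s : 'S_n) : weight s = fps_monomial (chain_poly 0 (perm_word s)).
Proof.
have E j : (0 < j)%N -> (chain_poly 0 (perm_word s))`_j = occ_incr j s.
  by case: j => // j _; rewrite occ_incrE coefD coef1 add0r.
rewrite (@fps_monomial_from1 _ n).
- by apply: eq_big_nat => j /andP[j0 _]; rewrite E.
- exact: chain_poly_coef0.
- by apply/leq_sizeP => j nj; rewrite E ?occ_incr_gt // (leq_ltn_trans _ nj).
Qed.

Lemma sum_weight n : \sum_(s : 'S_n | motzkin s) weight s = motzkin_gf 0 n.
Proof.
rewrite -big_filter /motzkin_gf.
under eq_bigr do rewrite weightE.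
rewrite -(big_map (@perm_word n) xpredT (fun w => fps_monomial (chain_poly 0 w))).
under [RHS]eq_bigr do rewrite expr0 mul1r.
apply: perm_big; apply: uniq_perm.
- by rewrite (map_inj_uniq (@perm_word_inj n)) filter_uniq ?index_enum_uniq.
- exact: motzkin_words_uniq.
move=> w; rewrite mem_motzkin_words; apply/mapP/andP.
  by case=> s; rewrite mem_filter motzkinE => /andP[ms _] ->; rewrite perm_perm_word.
case=> /perm_word_onto[s <-] ms; exists s => //.
by rewrite mem_filter motzkinE ms mem_index_enum.
Qed.

Theorem theorem3p2 :
  exists2 F : fps,
    fps_cvg (fun N : nat =>
      \sum_(0 <= n < N) \sum_(s : 'S_n | motzkin s) weight s) F
  & fps_cvg (jfrac_convergent cf_a cf_b) F.
Proof.
exists (motzkin_series 0); last exact: jfrac_convergent_cvg.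
apply: fps_cvg_order => N; under eq_bigr do rewrite sum_weight.
exact: motzkin_seriesE.
Qed.
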